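(* Let the standing assumptions (i)–(v) and the solvability assumption of the context hold ($f$ possibly nonconvex). Suppose GA-BPGnc (described in the context) has not returned a stationary point in its first $N\ge2$ iterations. Let $\mathcal A_N=\{1\le k\le N:\delta_k>0\}$, $\underline\lambda=\min\{\lambda_0,1/(\gamma_-L)\}>0$, and $\tau_k=\dfrac{2\delta_k}{\lambda_k\mathcal R_{\lambda_k}(x_k)}$. Then $$\min_{k\in\mathcal A_N}\mathcal R_{\lambda_k}(x_k)\le\frac{2(\Phi(y_0)-\Phi^\star)}{\sum_{k\in\mathcal A_N}\tau_k\lambda_k}\le\frac{4(\Phi(y_0)-\Phi^\star)}{\sigma\underline\lambda(N-1)}.$$ Thus a residual $\mathcal R_{\lambda_k}(x_k)\le\varepsilon^2$ is obtained within $O(\varepsilon^{-2})$ outer iterations and $O(\varepsilon^{-2})$ BPG subproblem solves (unless a stationary point is returned earlier).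
   Context: Notation. $\langle\cdot,\cdot\rangle$ and $\|\cdot\|$ are the Euclidean inner product and norm on $\mathbb R^n$. For $h:\mathbb R^n\to(-\infty,+\infty]$, $\operatorname{dom}h=\{h<+\infty\}$ and $h^*$ is the convex conjugate. A proper lower semicontinuous convex function is Legendre if it is essentially smooth and essentially strictly convex; then $\nabla h^*=(\nabla h)^{-1}$ on $\operatorname{int}\operatorname{dom}h^*$. For $v$ where $h$ is differentiable, $D_h(u,v)=h(u)-h(v)-\langle\nabla h(v),u-v\rangle$; the same notation is used for (possibly nonconvex) $f$. Standing assumptions. (i) $\psi:\mathbb R^n\to(-\infty,+\infty]$ is Legendre and $\Omega=\operatorname{int}\operatorname{dom}\psi$ (nonempty open convex). (ii) $f:\mathbb R^n\to(-\infty,+\infty]$ is proper, lower semicontinuous, $\operatorname{dom}\psi\subset\operatorname{dom}f$, and $f$ is continuously differentiable on $\Omega$. (iii) $\rho:\mathbb R^n\to(-\infty,+\infty]$ is proper, lower semicontinuous, convex, with $\Omega\cap\operatorname{dom}\rho\ne\emptyset$. (iv) There is $L>0$ with $D_f(u,v)\le L D_\psi(u,v)$ for all $u,v\in\Omega$. (v) With $\Phi=f+\rho$, $\Phi^\star=\inf_{x\in\operatorname{cl}\Omega}\Phi(x)>-\infty$. A point $x\in\Omega$ is stationary if $0\in\nabla f(x)+\partial\rho(x)$. BPG map. For $x\in\Omega$, $\lambda>0$, $$T_\lambda(x)=\operatorname{argmin}_{u\in\operatorname{cl}\Omega}\{\rho(u)+\langle\nabla f(x),u-x\rangle+\lambda^{-1}D_\psi(u,x)\}.$$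 Solvability assumption: $T_\lambda(x)\neq\emptyset$ for every $x\in\Omega$, $\lambda>0$ (the minimizer is then unique and lies in $\Omega$). For $x\in\Omega\cap\operatorname{dom}\rho$ and $\widehat y\in T_\lambda(x)$ put $$\mathcal R_\lambda(x)=-\frac2\lambda\left(\langle\nabla f(x),\widehat y-x\rangle+\rho(\widehat y)-\rho(x)+\lambda^{-1}D_\psi(\widehat y,x)\right).$$ GA-BPGnc. Inputs: a Legendre function $\phi:\mathbb R^n\to(-\infty,+\infty]$; $y_0\in\Omega\cap\operatorname{dom}\rho$; $\lambda_{\max}\ge\lambda_0>0$; $\gamma_+\ge1$, $\gamma_->1$; $\sigma\in(0,1)$; a rule choosing weights $\beta_j\ge0$. Set $z_0=y_0$. For $k=1,2,\dots$: set $\lambda=\lambda_0$ if $k=1$ and $\lambda=\min\{\gamma_+\lambda_{k-1},\lambda_{\max}\}$ if $k\ge2$; choose $\beta_{k+1}\ge0$ from the available history; set $x_k=z_{k-1}$. Compute $\widehat y\in T_\lambda(x_k)$; if $\widehat y=x_k$ stop and return $x_k$ (a stationary point); if $D_f(\widehat y,x_k)>\lambda^{-1}D_\psi(\widehat y,x_k)$, replace $\lambda$ by $\lambda/\gamma_-$ and recompute $\widehat y$ (same $x_k$, same $\beta_{k+1}$). When the test passes, set $\lambda_k=\lambda$, $\widehat y_k=\widehat y$, $\delta_k=\Phi(y_{k-1})-\Phi(\widehat y_k)$; set $y_k=\widehat y_k$ if $\delta_k>0$ and $y_k=y_{k-1}$ otherwise. By default $z_k=y_k$. If $\delta_k\ge\frac{\sigma\lambda_k}2\mathcal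 R_{\lambda_k}(x_k)$, $y_k,y_{k-1}\in\operatorname{int}\operatorname{dom}\phi$, $p=\nabla\phi(y_k)+\beta_{k+1}[\nabla\phi(y_k)-\nabla\phi(y_{k-1})]\in\operatorname{int}\operatorname{dom}\phi^*$, and $\widehat z=\nabla\phi^*(p)\in\Omega\cap\operatorname{dom}\rho$, set instead $z_k=\widehat z$. Each computation of a point of $T_\lambda(x)$, including rejected trials, is one BPG subproblem solve. *)

(* Defs.v *)
From HB Require Import structures.
From mathcomp Require Import all_boot all_order all_algebra.
From mathcomp Require Import all_classical all_reals all_analysis.

Set Implicit Arguments.
Unset Strict Implicit.
Unset Printing Implicit Defensive.

Import Order.TTheory GRing.Theory Num.Theory numFieldNormedType.Exports.

Local Open Scope classical_set_scope.
Local Open Scope ring_scope.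

(* Vectors of R^n are row vectors.  The library norm on 'rV[R]_n is the sup
   norm; it induces the Euclidean topology and the same differentiability, so
   it is used for limits, interiors, closures and differentials, while inner
   products and norms of vectors are the Euclidean ones below. *)

Definition dot (R : realType) (n : nat) (u v : 'rV[R]_n) : R :=
  \sum_i u ord0 i * v ord0 i.

Definition enorm (R : realType) (n : nat) (u : 'rV[R]_n) : R :=
  Num.sqrt (dot u u).

Section ExtendedFunctions.
Context {R : realType} {n : nat}.
Implicit Types (h : 'rV[R]_n -> \bar R) (x y u v g : 'rV[R]_n).

Definition edom h : set 'rV[R]_n := [set x | (h x < +oo)%E].

(* Functions to (-oo, +oo] are functions to \bar R; the exclusion of the
   value -oo is part of properness. *)
Definition eproper h : Prop := (forall x, (-oo < h x)%E) /\ edom h !=set0.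

(* With the convention 0 * +oo = 0 of \bar R, the endpoints t = 0 and t = 1
   are trivial. *)
Definition econvex h : Prop := forall x y (t : R), 0 <= t <= 1 ->
  (h (t *: x + (1 - t) *: y)%R <= t%:E * h x + (1 - t)%R%:E * h y)%E.

Definition subdifferential h x : set 'rV[R]_n :=
  [set g | forall y, (h x + (dot g (y - x)%R)%:E <= h y)%E].

Definition conjugate h : 'rV[R]_n -> \bar R :=
  fun y => ereal_sup [set ((dot y x)%:E - h x)%E | x in setT].

Definition ediff h v : Prop :=
  (\forall w \near v, h w \is a fin_num) /\ differentiable (fine \o h) v.

(* Meaningful where [ediff h v] holds. *)
Definition grad h v : 'rV[R]_n :=
  \row_i ('d (fine \o h) v (delta_mx ord0 i : 'rV[R]_n)).

Definition C1_on (A : set 'rV[R]_n) h : Prop :=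
  forall x, A x -> ediff h x /\ {for x, continuous (grad h)}.

Definition bregman h u v : \bar R :=
  (h u - h v - (dot (grad h v) (u - v)%R)%:E)%E.

Definition essentially_smooth h : Prop :=
  [/\ interior (edom h) !=set0,
      forall x, interior (edom h) x -> ediff h x
    & forall (s : nat -> 'rV[R]_n) x,
        (forall i, interior (edom h) (s i)) ->
        (closure (interior (edom h)) `\` interior (edom h)) x ->
        s i @[i --> \oo] --> x ->
        enorm (grad h (s i)) @[i --> \oo] --> +oo].

Definition essentially_strictly_convex h : Prop :=
  forall C : set (convex_lmodType 'rV[R]_n), convex_set C ->
    C `<=` [set x | subdifferential h x !=set0] ->
    forall x y (t : R), C x -> C y -> x != y -> 0 < t < 1 ->
      (h (t *: x + (1 - t) *: y)%R < t%:E * h x + (1 - t)%R%:E * h y)%E.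

Definition legendre h : Prop :=
  [/\ eproper h, lower_semicontinuous h, econvex h,
      essentially_smooth h & essentially_strictly_convex h].

End ExtendedFunctions.

Record problem (R : realType) (n : nat) := Problem {
  psi : 'rV[R]_n -> \bar R;
  smooth_part : 'rV[R]_n -> \bar R;
  rho : 'rV[R]_n -> \bar R }.

Record inputs (R : realType) (n : nat) := Inputs {
  y0 : 'rV[R]_n;
  lambda0 : R;
  lambda_max : R;
  gamma_plus : R;
  gamma_minus : R;
  sigma : R }.

Section Algorithm.
Context {R : realType} {n : nat}.
Context (pb : problem R n) (al : inputs R n).
Local Notation V := 'rV[R]_n.
Local Notation f := (smooth_part pb).

Definition Omega : set V := interior (edom (psi pb)).

Definition Phi (x : V) : \bar R := (f x + rho pb x)%E.

Definition Phi_star : \bar R := ereal_inf [set Phi x | x in closure Omega].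

Definition stationary (x : V) : Prop :=
  Omega x /\ exists2 g, subdifferential (rho pb) x g & 0 = grad f x + g.

Definition bpg_objective (l : R) (x u : V) : \bar R :=
  (rho pb u + (dot (grad f x) (u - x)%R)%:E
   + (l^-1)%R%:E * bregman (psi pb) u x)%E.

Definition bpg_map (l : R) (x : V) : set V :=
  [set u | closure Omega u /\
     forall w, closure Omega w ->
       (bpg_objective l x u <= bpg_objective l x w)%E].

(* R_l(x), written with a minimizer y in [bpg_map l x]; the minimizer being
   unique, the value depends on l and x only. *)
Definition residual (l : R) (x y : V) : \bar R :=
  (- ((2 / l)%R%:E *
      ((dot (grad f x) (y - x)%R)%:E + rho pb y - rho pb x
       + (l^-1)%R%:E * bregman (psi pb) y x)))%E.

(* Data of a completed outer iteration k: x_k, y_(k-1), beta_(k+1), lambda_k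
   and the accepted trial point. *)
Record iteration := Iteration {
  it_x : V;
  it_yprev : V;
  it_beta : R;
  it_lambda : R;
  it_yhat : V }.

Definition delta (it : iteration) : \bar R :=
  (Phi (it_yprev it) - Phi (it_yhat it))%E.

Definition it_residual (it : iteration) : \bar R :=
  residual (it_lambda it) (it_x it) (it_yhat it).

Definition tau (it : iteration) : \bar R :=
  (2%:E * delta it / ((it_lambda it)%:E * it_residual it))%E.

Definition it_y (it : iteration) : V :=
  if (0 < delta it)%E then it_yhat it else it_yprev it.

Definition extrapolated (phi : V -> \bar R) (it : iteration) : V :=
  grad phi (it_y it)
  + it_beta it *: (grad phi (it_y it) - grad phi (it_yprev it)).

Definition it_z (phi : V -> \bar R) (it : iteration) : V :=
  let p := extrapolated phi it in
  let zhat := grad (conjugate phi) p in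
  if `[< [/\ ((sigma al * it_lambda it / 2)%R%:E * it_residual it
                <= delta it)%E,
             interior (edom phi) (it_y it),
             interior (edom phi) (it_yprev it),
             interior (edom (conjugate phi)) p
           & (Omega `&` edom (rho pb)) zhat] >]
  then zhat else it_y it.

(* Completed iterations are listed in chronological order. *)
Definition current_y (h : seq iteration) : V :=
  last (y0 al) [seq it_y it | it <- h].

Definition current_x (phi : V -> \bar R) (h : seq iteration) : V :=
  last (y0 al) [seq it_z phi it | it <- h].

Definition first_trial (h : seq iteration) : R :=
  if h is [::] then lambda0 al
  else Num.min (gamma_plus al * last (lambda0 al) [seq it_lambda it | it <- h])
               (lambda_max al).

(* [Running h b l]: the iterations of h are completed, and the next
   subproblem is solved with weight b and trial parameter l.
   [Returned h x]: iteration (size h).+1 returned x. *)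
Inductive config :=
| Running of seq iteration & R & R
| Returned of seq iteration & V.

Definition history (c : config) : seq iteration :=
  match c with Running h _ _ => h | Returned h _ => h end.

Definition outer_iterations (c : config) : nat :=
  match c with Running h _ _ => size h | Returned h _ => (size h).+1 end.

(* Each step out of a [Running] configuration is one BPG subproblem solve.
   The weight of the next iteration is any b' >= 0, so that every rule
   choosing the weights from the past is covered. *)
Inductive step (phi : V -> \bar R) : config -> config -> Prop :=
| step_return h b l of
    bpg_map l (current_x phi h) (current_x phi h) :
    step phi (Running h b l) (Returned h (current_x phi h))
| step_reject h b l yhat of
    bpg_map l (current_x phi h) yhat &
    yhat <> current_x phi h &
    ((l^-1)%R%:E * bregman (psi pb) yhat (current_x phi h)
       < bregman f yhat (current_x phi h))%E :
    step phi (Running h b l) (Running h b (l / gamma_minus al))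
| step_accept h b l yhat (b' : R) of
    bpg_map l (current_x phi h) yhat &
    yhat <> current_x phi h &
    (bregman f yhat (current_x phi h)
       <= (l^-1)%R%:E * bregman (psi pb) yhat (current_x phi h))%E &
    0 <= b' :
    let h' :=
      rcons h (Iteration (current_x phi h) (current_y h) b l yhat) in
    step phi (Running h b l) (Running h' b' (first_trial h'))
| step_halted h x : step phi (Returned h x) (Returned h x).

(* [s j] is the configuration after j subproblem solves (fewer if the
   algorithm has returned before). *)
Definition execution (phi : V -> \bar R) (s : nat -> config) : Prop :=
  (exists2 b, 0 <= b & s 0%N = Running [::] b (first_trial [::])) /\
  forall j, step phi (s j) (s j.+1).

Definition returned_within (s : nat -> config) (N : nat) : Prop :=
  exists j h x, s j = Returned h x /\ (size h < N)%N.

Definition returned_stationary (c : config) : Prop :=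
  exists h x, c = Returned h x /\ stationary x.

Definition lambda_low (L : R) : R :=
  Num.min (lambda0 al) (1 / (gamma_minus al * L)).

End Algorithm.

Arguments iteration R n : clear implicits.
Arguments config R n : clear implicits.

(* Main.v *)
Require Import Defs.
From HB Require Import structures.
From mathcomp Require Import all_boot all_order all_algebra.
From mathcomp Require Import all_classical all_reals all_analysis.
From mathcomp Require Import zify ring lra.

Set Implicit Arguments.
Unset Strict Implicit.
Unset Printing Implicit Defensive.

Import Order.TTheory GRing.Theory Num.Theory numFieldNormedType.Exports.

Local Open Scope classical_set_scope.
Local Open Scope ring_scope.

(** The residual of a BPG step from x is 2/l times the amount by which the
minimizer y improves the model objective over x itself, and the acceptance test
says that f x plus this objective majorizes Phi at y. An accepted step
therefore decreases Phi by at least l/2 times the residual, measured from the point x_k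
where the step was taken (bpg_accept).

The difficulty is that x_k may be an extrapolated point, at which Phi is
uncontrolled. Extrapolation is only used right after an iteration which is
good, meaning delta_k >= sigma lambda_k R_k / 2, and an iteration with x_k =
y_(k-1) is good because sigma < 1. Hence of two consecutive iterations at least
one is good, and at least half of all iterations are (history_ok_rcons). Each
good iteration adds at least sigma lambda_low to the sum of tau_k lambda_k
(weight_ge_count).

On the other hand tau_k lambda_k R_k = 2 delta_k, and the delta_k over the
iterations that move y telescope to Phi(y_0) - Phi(y_N), at most the gap; so
some R_k is at most twice the gap divided by the sum of the tau_k lambda_k
(exists_small_residual).

Two facts keep the algorithm running. The minimizer of a subproblem lies in
Omega, because a Legendre function has slope -oo at the boundary of its domain
in every direction pointing inwards, which no minimizer tolerates
(boundary_slope, bpg_map_feasible). And a trial is rejected only when l > 1/L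
(bpg_reject_gt), so the trial parameters stay between lambda_low and
lambda_max; the number of consecutive rejections is then bounded uniformly in
the run, and the number of subproblem solves is at most a constant times the
number of iterations (config_ok_step). *)

(** * Gradients and convexity of extended functions *)

Section ConvexAnalysis.
Context {R : realType} {n : nat}.
Local Notation V := 'rV[R]_n.
Implicit Types (h : V -> \bar R) (x y u v d g : V).

Lemma dotDr g u v : dot g (u + v) = dot g u + dot g v.
Proof. by rewrite -big_split; apply: eq_bigr => i _; rewrite mxE mulrDr. Qed.

Lemma dotZr g (a : R) u : dot g (a *: u) = a * dot g u.
Proof.
by rewrite /dot mulr_sumr; apply: eq_bigr => i _; rewrite mxE mulrCA.
Qed.

Lemma dotNr g u : dot g (- u) = - dot g u.
Proof. by rewrite -scaleN1r dotZr mulN1r. Qed.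

Lemma dotNl g u : dot (- g) u = - dot g u.
Proof. by rewrite /dot -sumrN; apply: eq_bigr => i _; rewrite mxE mulNr. Qed.

Lemma dot0r g : dot g 0 = 0.
Proof. by rewrite -(scale0r 0) dotZr mul0r. Qed.

Lemma dot_delta g i : dot g (delta_mx ord0 i) = g ord0 i.
Proof.
rewrite /dot (bigD1 i) //= mxE !eqxx mulr1 big1 ?addr0 // => j /negPf ji.
by rewrite mxE eqxx ji mulr0.
Qed.

Lemma enorm_le g (B : 'I_n -> R) : (forall i, `|g ord0 i| <= B i) ->
  enorm g <= Num.sqrt (\sum_i B i ^+ 2).
Proof.
move=> gB; apply: ler_wsqrtr; apply: ler_sum => i _.
rewrite -expr2 -real_normK ?num_real //.
by rewrite ler_pXn2r ?nnegrE ?normr_ge0 // (le_trans _ (gB i)).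
Qed.

Lemma diff_grad h v u : 'd (fine \o h) v u = dot (grad h v) u.
Proof.
rewrite /dot [in LHS](row_sum_delta u) linear_sum.
by apply: eq_bigr => i _; rewrite linearZ /= mxE mulrC.
Qed.

Lemma ediff_real h x : ediff h x -> exists a : R, h x = a%:E.
Proof. by case=> /nbhs_singleton/EFin_fin_numP. Qed.

Lemma edom_real h x : eproper h -> edom h x -> exists a : R, h x = a%:E.
Proof.
by move=> [/(_ x) + _]; rewrite /edom /=; case: (h x) => // a _ _; exists a.
Qed.

(** First-order expansion along a ray, for a single small t at which any
property holding near x may be required as well: one such t is enough to
contradict a strict inequality of slopes. *)
Lemma ediff_expand h x d (e : R) (P : V -> Prop) :
  ediff h x -> 0 < e -> (\forall w \near x, P w) ->
  exists2 t : R, 0 < t < 1 &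
   [/\ h (x + t *: d) \is a fin_num, P (x + t *: d) &
   `|fine (h (x + t *: d)) - fine (h x) - t * dot (grad h x) d| <= e * t].
Proof.
move=> [hfin hdif] e0 Px.
have dcvg := @diff_derivable _ _ _ _ _ d hdif.
have dE : 'D_d (fine \o h) x = dot (grad h x) d 
  by rewrite deriveE // diff_grad.
have /cvgrPdist_le/(_ _ e0) : t^-1 *: (((fine \o h) \o shift x) (t *: d)
    - (fine \o h) x) @[t --> 0^'] --> dot (grad h x) d by rewrite -dE.
have lcvg : (x + t *: d) @[t --> (0 : R)^'] --> x.
  apply: cvg_within_filter.
  have : (x + t *: d) @[t --> (0 : R)] --> x + 0 *: d.
    by apply: cvgD; [exact: cvg_cst|apply: cvgZ; [exact: cvg_id|exact: cvg_cst]].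
  by rewrite scale0r addr0.
have near1 := lcvg _ hfin; have near2 := lcvg _ Px.
rewrite /= in near1 near2 => near3.
have : \forall t \near (0 : R)^', [/\ h (x + t *: d) \is a fin_num,
    P (x + t *: d) & `|dot (grad h x) d -
     t^-1 *: (((fine \o h) \o shift x) (t *: d) - (fine \o h) x)| <= e].
  by near=> t; split; near: t.
move=> /nbhs_ballP[r /= r0 rP].
pose t := Num.min (r / 2) (1 / 2).
have t0 : 0 < t by rewrite /t lt_min !divr_gt0.
have tr : t < r by rewrite /t gt_min; apply/orP; left; lra.
have t1 : t < 1 by rewrite /t gt_min; apply/orP; right; lra.
exists t; first by rewrite t0.
have [||? ? H] := rP t; first by rewrite /ball /= sub0r normrN gtr0_norm.
  by rewrite gt_eqF.
split=> //; move: H; rewrite /= (addrC _ x) => H.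
rewrite (_ : _ - _ = - ((dot (grad h x) d
    - t^-1 * (fine (h (x + t *: d)) - fine (h x))) * t)).
  by rewrite normrN normrM (gtr0_norm t0) ler_pM2r.
by field; rewrite gt_eqF.
Unshelve. all: by end_near. Qed.

Lemma econvex_fin h x y (a b t : R) : eproper h -> econvex h ->
  h x = a%:E -> h y = b%:E -> 0 <= t <= 1 ->
  exists2 c : R, h (t *: x + (1 - t) *: y) = c%:E & c <= t * a + (1 - t) * b.
Proof.
move=> [hgt _] hcvx xa yb t01.
have := hcvx x y t t01; rewrite xa yb -!EFinM -EFinD.
case: (h _) (hgt (t *: x + (1 - t) *: y)) => // c _.
by rewrite lee_fin => ?; exists c.
Qed.

(** If h y lay below the tangent, convexity would force a slope smaller than
the derivative at x on the way to y. *)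
Lemma econvex_ge_tangent h x y : eproper h -> econvex h -> ediff h x ->
  (h x + (dot (grad h x) (y - x))%:E <= h y)%E.
Proof.
move=> hp hcvx hd; have [a xa] := ediff_real hd.
case yb : (h y) (hp.1 y) => [b||] // _; last by rewrite leey.
rewrite xa -EFinD lee_fin leNgt; apply/negP => lt_b.
set s := dot _ _ in lt_b.
have e0 : 0 < (a + s - b) / 2 by lra.
have [t /andP[t0 t1] [_ _]] :=
  ediff_expand (y - x) hd e0 (filterT : \forall w \near x, True).
have t01 : 0 <= t <= 1 by rewrite !ltW.
have [c] := econvex_fin hp hcvx yb xa t01.
have -> : t *: y + (1 - t) *: x = x + t *: (y - x).
  by rewrite scalerBl scale1r scalerBr addrCA.
move=> -> cle; rewrite xa /= ler_norml -/s => /andP[cge _].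
by clear xa yb; have := mulr_gt0 t0 e0; lra.
Qed.

End ConvexAnalysis.

(** * Essential smoothness and boundary points *)

Section EssentialSmoothness.
Context {R : realType} {n : nat}.
Local Notation V := 'rV[R]_n.
Implicit Types (h : V -> \bar R) (x y d : V).

(** The point is the image of x under a homothety of centre y that maps the
domain into itself, so a neighbourhood of x becomes a neighbourhood of it. *)
Lemma interior_segment h x y (t : R) : eproper h -> econvex h ->
  interior (edom h) x -> edom h y -> 0 < t <= 1 ->
  interior (edom h) (t *: x + (1 - t) *: y).
Proof.
move=> hp hcvx xint ydom /andP[t0 t1].
pose back (w : V) : V := t^-1 *: (w - (1 - t) *: y).
have back_cont : continuous back.
    move=> w; apply: (@cvgZl_tmp _ _ _ _ (nbhs_filter w)).
  by apply: (cvgB (FF := nbhs_filter w)); [exact: cvg_id|exact: cvg_cst].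
have back_x : back (t *: x + (1 - t) *: y) = x.
  by rewrite /back addrK scalerA mulVf ?scale1r ?gt_eqF.
apply: (filterS (Filter := nbhs_filter _) _ (back_cont _ (edom h) _)); last first.
  by rewrite back_x.
move=> w bw.
rewrite /edom /=; have {}bw : edom h (back w) := bw.
have -> : w = t *: back w + (1 - t) *: y.
  by rewrite /back scalerA mulfV ?scale1r ?subrK ?gt_eqF.
have [a ya] := edom_real hp ydom; have [b wb] := edom_real hp bw.
have t01 : 0 <= t <= 1 by rewrite t1 ltW.
by have [c -> _] := econvex_fin hp hcvx wb ya t01; rewrite ltry.
Qed.

(** If h decreases at most linearly when one leaves y towards x, then the
gradients along the segment have a slope at least - C in the direction x - y.
The tangent inequality at the fixed point x + r d of the domain then bounds
them from above in the direction d. *)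
Lemma grad_segment_bounded h x y (b C : R) d :
  eproper h -> econvex h -> (forall z, interior (edom h) z -> ediff h z) ->
  interior (edom h) x -> h y = b%:E ->
  (forall t : R, 0 < t <= 1 ->
    ((b - C * t)%:E <= h (t *: x + (1 - t) *: y)%R)%E) ->
  exists B : R, forall t : R, 0 < t <= 1 ->
    dot (grad h (t *: x + (1 - t) *: y)) d <= B.
Proof.
move=> hp hcvx hdiff xint yb hge.
have xd := hdiff _ xint.
have [a xa] := ediff_real xd.
have [r /andP[r0 _] [/EFin_fin_numP[c uc] _ _]] :=
  ediff_expand d xd ltr01 (filterT : \forall w \near x, True).
exists ((c - a + `|dot (grad h x) (y - x)| + `|C|) / r) => t t01.
have /andP[t0 t1] := t01.
set w := t *: x + (1 - t) *: y.
have wint : interior (edom h) w.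
  by apply: interior_segment => //; rewrite /edom /= yb ltry.
have wd := hdiff _ wint.
have [e we] := ediff_real wd.
have := hge t t01; rewrite -/w we lee_fin => bCe.
have Hy := econvex_ge_tangent y hp hcvx wd.
have Hu := econvex_ge_tangent (x + r *: d) hp hcvx wd.
have Hx := econvex_ge_tangent w hp hcvx xd.
rewrite we yb -EFinD lee_fin in Hy; rewrite we uc -EFinD lee_fin in Hu.
rewrite we xa -EFinD lee_fin in Hx.
move: (grad h w) (grad h x) Hy Hu Hx => g g0.
have -> : y - w = (- t) *: (x - y) by apply/rowP => i; rewrite !mxE; ring.
have -> : x + r *: d - w = (1 - t) *: (x - y) + r *: d.
  by apply/rowP => i; rewrite !mxE; ring.
have -> : w - x = (1 - t) *: (y - x) by apply/rowP => i; rewrite !mxE; ring.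
rewrite (dotDr g (_ *: _)) !dotZr => Hy Hu Hx.
rewrite ler_pdivlMr // mulrC.
set q := dot g (x - y) in Hy Hu; set s := dot g0 (y - x) in Hx *.
have qC : - `|C| <= q.
  have : - C * t <= q * t by lra.
  by rewrite ler_pM2r //; have := ler_norm C; lra.
have tq : - `|C| <= (1 - t) * q by have := normr_ge0 C; nra.
have ts : - `|s| <= (1 - t) * s.
  by have := normr_ge0 s; have := ler_norm (- s); rewrite normrN; nra.
clear xa yb uc we; lra.
Qed.

(** Otherwise the gradients along the segment, bounded in each of the
directions of the coordinate axes, would stay bounded on a sequence converging
to the boundary point y, against essential smoothness. *)
Lemma boundary_slope h x y (b C : R) :
  eproper h -> econvex h -> essentially_smooth h ->
  interior (edom h) x -> closure (interior (edom h)) y -> h y = b%:E ->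
  (forall t : R, 0 < t <= 1 ->
    ((b - C * t)%:E <= h (t *: x + (1 - t) *: y)%R)%E) ->
  interior (edom h) y.
Proof.
move=> hp hcvx [_ hdiff hblow] xint ycl yb hge; apply: contrapT => yint.
pose w i : V := harmonic i *: x + (1 - harmonic i) *: y.
have h01 i : 0 < (harmonic i : R) <= 1.
  by rewrite /harmonic /= invr_gt0 ltr0n /= invf_le1 ?ler1n ?ltr0n.
have wcvg : w i @[i --> \oo] --> y.
  have : w i @[i --> \oo] --> (0 : R) *: x + (1 - 0) *: y.
    apply: cvgD; apply: cvgZ; try exact: cvg_cst; first exact: cvg_harmonic.
    by apply: cvgB; [exact: cvg_cst|exact: cvg_harmonic].
  by rewrite scale0r add0r subr0 scale1r.
have wint i : interior (edom h) (w i).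
  by apply: interior_segment => //; rewrite /edom /= yb ltry.
have /choice[B gB] :
    forall j, exists B : R, forall i, `|grad h (w i) ord0 j| <= B.
  move=> j; pose e : V := delta_mx ord0 j.
  have [B1 H1] := grad_segment_bounded e hp hcvx hdiff xint yb hge.
  have [B2 H2] := grad_segment_bounded (- e) hp hcvx hdiff xint yb hge.
  exists (Num.max B1 B2) => i; rewrite ler_norml lerNl !le_max.
  have := H1 _ (h01 i); have := H2 _ (h01 i).
  by rewrite dotNr !dot_delta => -> ->; rewrite !orbT.
have /cvgryPgt/(_ (Num.sqrt (\sum_j B j ^+ 2))) :=
  hblow w y wint (conj ycl yint) wcvg.
move=> /filter_ex[i]; rewrite ltNge => /negP; apply.
exact: enorm_le.
Qed.
End EssentialSmoothness.

(** * The BPG subproblem *)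

Record standing (R : realType) (n : nat) (pb : problem R n) (L : R) : Prop :=
  Standing {
    psi_legendre : legendre (psi pb);
    f_proper : eproper (smooth_part pb);
    dom_psi_f : edom (psi pb) `<=` edom (smooth_part pb);
    rho_proper : eproper (rho pb);
    rho_convex : econvex (rho pb);
    L_gt0 : 0 < L;
    bregman_le : forall u v, Omega pb u -> Omega pb v ->
      (bregman (smooth_part pb) u v <= L%:E * bregman (psi pb) u v)%E;
    Phi_star_gtNy : (-oo < Phi_star pb)%E }.

Section BPGStep.
Context {R : realType} {n : nat} (pb : problem R n) (L : R).
Context (st : standing pb L).
Local Notation V := 'rV[R]_n.
Local Notation f := (smooth_part pb).
Local Notation Omega := (Omega pb).
Implicit Types (x y u w d g : V) (l : R).

Definition feasible x : Prop := (Omega `&` edom (rho pb)) x.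

Lemma Omega_dom x : Omega x -> edom (psi pb) x.
Proof. exact: interior_subset. Qed.

Lemma psi_ediff x : Omega x -> ediff (psi pb) x.
Proof. by have [_ _ _ [_ + _] _] := psi_legendre st; apply. Qed.

Lemma psi_proper : eproper (psi pb).
Proof. by have [] := psi_legendre st. Qed.

Lemma psi_convex : econvex (psi pb).
Proof. by have [] := psi_legendre st. Qed.

Lemma feasible_real x : feasible x ->
  exists p q c : R, [/\ psi pb x = p%:E, rho pb x = q%:E & f x = c%:E].
Proof.
move=> [xO xr]; have [p xp] := edom_real psi_proper (Omega_dom xO).
have [q xq] := edom_real (rho_proper st) xr.
have [c xc] := edom_real (f_proper st) (dom_psi_f st (Omega_dom xO)).
by exists p, q, c.
Qed.

(** The subproblem objective when all values are finite. The gradients of f and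
psi at x enter as arbitrary vectors g and g', so that the computations below
treat them as opaque. *)
Definition real_objective l g g' x (p0 : R) u (p q : R) : R :=
  q + dot g (u - x) + l^-1 * (p - p0 - dot g' (u - x)).

Lemma bpg_objectiveE l x u g g' (p0 p q : R) :
  grad f x = g -> grad (psi pb) x = g' ->
  psi pb x = p0%:E -> psi pb u = p%:E -> rho pb u = q%:E ->
  bpg_objective pb l x u = (real_objective l g g' x p0 u p q)%:E.
Proof. by rewrite /bpg_objective /bregman => -> -> -> -> ->. Qed.

Lemma real_objective_self l g g' x (p q : R) :
  real_objective l g g' x p x p q = q.
Proof.
by rewrite /real_objective !subrr (dot0r g) (dot0r g') subr0 mulr0 !addr0.
Qed.

Lemma real_objective_dir l g g' x (p0 : R) u d (t p q : R) : u - x = t *: d ->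
  real_objective l g g' x p0 u p q =
  q + t * dot g d + l^-1 * (p - p0 - t * dot g' d).
Proof. by move=> ud; rewrite /real_objective ud (dotZr g) (dotZr g'). Qed.

Lemma closure_Omega x : Omega x -> closure Omega x.
Proof. exact: subset_closure. Qed.

Lemma bpg_map_real l x y : 0 < l -> feasible x -> bpg_map pb l x y ->
  exists p q : R, psi pb y = p%:E /\ rho pb y = q%:E.
Proof.
move=> l0 xfeas [_ /(_ _ (closure_Omega xfeas.1))].
have [p0 [q0 [_ [xp xq _]]]] := feasible_real xfeas.
rewrite (bpg_objectiveE _ erefl erefl xp xp xq) real_objective_self.
rewrite /bpg_objective /bregman xp.
case: (psi pb y) (psi_proper.1 y) => [p _||] //.
  case: (rho pb y) ((rho_proper st).1 y) => [q _ _||] //; by exists p, q.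
move=> _; rewrite /= gt0_muley ?lte_fin ?invr_gt0 //.
by case: (rho pb y) ((rho_proper st).1 y).
Qed.

(** Comparing the minimizer y with the points of the segment to x shows that
psi decreases at most linearly when leaving y, with the constant C below. *)
Lemma bpg_map_feasible l x y : 0 < l -> feasible x -> bpg_map pb l x y ->
  feasible y.
Proof.
move=> l0 xfeas ymin; have [p [q [yp yq]]] := bpg_map_real l0 xfeas ymin.
split; last by rewrite /edom /= yq ltry.
have [p0 [q0 [_ [xp xq _]]]] := feasible_real xfeas.
have [psip _ psic psis _] := psi_legendre st.
have [g fx] : {g | grad f x = g} by exists (grad f x).
have [g' psix] : {g' | grad (psi pb) x = g'} by exists (grad (psi pb) x).
pose C := dot g' (y - x)
          - l * (q - q0 + dot g (y - x)).
apply: (boundary_slope (C := C) psip psic psis xfeas.1 ymin.1 yp) => t t01.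
set w := t *: x + (1 - t) *: y.
have wO : Omega w.
  by apply: interior_segment => //; [exact: xfeas.1|rewrite /edom /= yp ltry].
have t01' : 0 <= t <= 1 by case/andP: t01 => /ltW -> ->.
have [qw wq qwle] := econvex_fin (rho_proper st) (rho_convex st) xq yq t01'.
have [pw wp] := edom_real psip (Omega_dom wO).
have := ymin.2 _ (closure_Omega wO).
rewrite (bpg_objectiveE _ fx psix xp yp yq).
rewrite (bpg_objectiveE _ fx psix xp wp wq) wp !lee_fin.
have wx : w - x = (1 - t) *: (y - x) by apply/rowP => i; rewrite !mxE; ring.
rewrite (real_objective_dir _ _ _ _ _ _ wx) /real_objective /C.
set s := dot g _; set s' := dot g' _.
move=> /(ler_wpM2l (ltW l0)); rewrite !mulrDr !mulrA mulfV ?gt_eqF // !mul1r.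
have := ler_wpM2l (ltW l0) qwle; clear; lra.
Qed.

(** If the minimizer did not improve on x, the midpoint of x and y would be
strictly better than both, by strict convexity of psi on Omega. *)
Lemma real_objective_lt l x y g g' (p0 q0 p q : R) : 0 < l -> feasible x ->
  bpg_map pb l x y -> y <> x ->
  grad f x = g -> grad (psi pb) x = g' ->
  psi pb x = p0%:E -> rho pb x = q0%:E -> psi pb y = p%:E -> rho pb y = q%:E ->
  real_objective l g g' x p0 y p q < q0.
Proof.
move=> l0 xfeas ymin yx fx psix xp xq yp yq; rewrite ltNge; apply/negP => ge_q0.
have yfeas := bpg_map_feasible l0 xfeas ymin.
have [psip _ psic _ psis] := psi_legendre st.
have h12 : 0 < (1 / 2 : R) < 1 by lra.
have h12' : 0 < (1 / 2 : R) <= 1 by lra.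
have h12'' : 0 <= (1 / 2 : R) <= 1 by lra.
set w := (1 / 2 : R) *: x + (1 - 1 / 2 : R) *: y.
have wO : Omega w.
  by apply: interior_segment => //; [exact: xfeas.1|rewrite /edom /= yp ltry].
have [pw wp] := edom_real psip (Omega_dom wO).
have [qw wq qwle] := econvex_fin (rho_proper st) (rho_convex st) xq yq h12''.
have pwlt : pw < 1 / 2 * p0 + (1 - 1 / 2) * p.
  rewrite -lte_fin -wp EFinD !EFinM -xp -yp.
  have xy : x != y by apply/eqP => xy; exact: yx.
  refine (psis Omega _ _ _ _ _ xfeas.1 yfeas.1 xy h12).
    move=> a b t /set_mem aO /set_mem bO; apply/mem_set.
    have t0 : 0 <= t%:num by [].
    have t1 : t%:num <= 1 by [].
    rewrite /conv /= /unstable.onem; case: (eqVneq t%:num 0) => [->|tn0].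
      by rewrite scale0r add0r subr0 scale1r.
    apply: interior_segment => //; first exact: Omega_dom.
    by rewrite t1 lt_neqAle eq_sym tn0 t0.
  move=> a aO; exists (grad (psi pb) a) => z.
  by apply: econvex_ge_tangent => //; exact: psi_ediff.
have := ymin.2 _ (closure_Omega wO).
rewrite (bpg_objectiveE _ fx psix xp yp yq).
rewrite (bpg_objectiveE _ fx psix xp wp wq) !lee_fin.
have wx : w - x = (1 / 2 : R) *: (y - x).
  by apply/rowP => i; rewrite !mxE; field.
have li0 : 0 < l^-1 by rewrite invr_gt0.
move: ge_q0; rewrite (real_objective_dir _ _ _ _ _ _ wx) /real_objective.
set s := dot g _; set s' := dot g' _.
move=> H1 H2; have := ltr_pM2l li0 pw (1 / 2 * p0 + (1 - 1 / 2) * p).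
rewrite pwlt => H3; clear - H1 H2 H3 qwle.
lra.
Qed.

(** Near x the Bregman term is of second order, so the minimality of x for the
subproblem is a first-order condition without it. *)
Lemma bpg_fixed_stationary l x : 0 < l -> feasible x -> bpg_map pb l x x ->
  stationary pb x.
Proof.
move=> l0 xfeas xmin; split; first exact: xfeas.1.
exists (- grad f x); last by rewrite subrr.
move=> y; have [p0 [q0 [_ [xp xq _]]]] := feasible_real xfeas.
case yq : (rho pb y) ((rho_proper st).1 y) => [q||] // _; last by rewrite leey.
have [g fx] : {g | grad f x = g} by exists (grad f x).
have [g' psix] : {g' | grad (psi pb) x = g'} by exists (grad (psi pb) x).
rewrite xq -EFinD lee_fin leNgt fx dotNl; apply/negP => lt_q.
set s := dot _ _ in lt_q.
have e0 : 0 < l * ((q0 - s - q) / 2) by rewrite mulr_gt0 //; lra.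
have [t /andP[t0 t1] [/EFin_fin_numP[pw wp] wO]] :=
  ediff_expand (y - x) (psi_ediff xfeas.1) e0
    (open_nbhs_nbhs (conj (open_interior _) xfeas.1)).
set w := x + _ in wp wO *.
have wE : w = t *: y + (1 - t) *: x by apply/rowP => i; rewrite !mxE; ring.
have t01 : 0 <= t <= 1 by rewrite !ltW.
have [qw wq qwle] := econvex_fin (rho_proper st) (rho_convex st) yq xq t01.
rewrite -wE in wq.
rewrite psix wp xp /= ler_norml => /andP[_ Hd].
have := xmin.2 _ (closure_Omega wO).
rewrite (bpg_objectiveE _ fx psix xp xp xq).
rewrite (bpg_objectiveE _ fx psix xp wp wq) lee_fin.
have wx : w - x = t *: (y - x) by apply/rowP => i; rewrite !mxE; ring.
rewrite real_objective_self (real_objective_dir _ _ _ _ _ _ wx) -/s => H.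
have li0 : 0 < l^-1 by rewrite invr_gt0.
have := ler_wpM2l (ltW li0) Hd.
rewrite !mulrA mulVf ?gt_eqF // mul1r.
have := mulr_gt0 t0 e0.
have : 0 < t * (q0 - s - q) by rewrite mulr_gt0 //; lra.
clear - H qwle; lra.
Qed.

Lemma Phi_star_le x : feasible x -> (Phi_star pb <= Phi pb x)%E.
Proof.
move=> [xO _]; apply: ereal_inf_lbound.
by exists x => //; exact: closure_Omega.
Qed.

Lemma Phi_real x : feasible x -> exists a : R, Phi pb x = a%:E.
Proof.
by move=> /feasible_real[_ [q [c [_ xq xc]]]]; exists (c + q);
  rewrite /Phi xq xc.
Qed.

(** For l <= 1/L the acceptance test is implied by the relative smoothness
inequality, as the Bregman distance of psi is nonnegative. *)
Lemma bpg_reject_gt l x y : 0 < l -> feasible x -> bpg_map pb l x y ->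
  ((l^-1)%:E * bregman (psi pb) y x < bregman f y x)%E -> 1 / L < l.
Proof.
move=> l0 xfeas ymin; have yfeas := bpg_map_feasible l0 xfeas ymin.
have [p0 [_ [_ [xp _ _]]]] := feasible_real xfeas.
have [p [_ [_ [yp _ _]]]] := feasible_real yfeas.
have := econvex_ge_tangent y psi_proper psi_convex (psi_ediff xfeas.1).
rewrite xp yp lee_fin => breg0 rej.
have := lt_le_trans rej (bregman_le st yfeas.1 xfeas.1).
rewrite /bregman xp yp -!EFinB -!EFinM lte_fin ltNge => lt_breg.
have L0 := L_gt0 st; rewrite ltNge; apply: contra lt_breg => le_l.
apply: ler_wpM2r; first by rewrite subr_ge0; move: breg0; clear; lra.
by rewrite -[L]invrK lef_pV2 ?posrE ?invr_gt0 // -div1r.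
Qed.

(** Sufficient decrease: the acceptance test bounds f y by its linearization at
x plus the Bregman term, hence Phi y by f x plus the optimal subproblem
value. *)
Lemma bpg_accept l x y : 0 < l -> feasible x -> bpg_map pb l x y -> y <> x ->
  (bregman f y x <= (l^-1)%:E * bregman (psi pb) y x)%E ->
  exists r a b : R, [/\ residual pb l x y = r%:E, Phi pb x = a%:E,
    Phi pb y = b%:E, 0 < r & l / 2 * r <= a - b].
Proof.
move=> l0 xfeas ymin yx; have yfeas := bpg_map_feasible l0 xfeas ymin.
have [p0 [q0 [c0 [xp xq xc]]]] := feasible_real xfeas.
have [p [q [c [yp yq yc]]]] := feasible_real yfeas.
have [g fx] : {g | grad f x = g} by exists (grad f x).
have [g' psix] : {g' | grad (psi pb) x = g'} by exists (grad (psi pb) x).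
have lt_q0 := real_objective_lt l0 xfeas ymin yx fx psix xp xq yp yq.
rewrite /bregman xc yc xp yp fx psix -!EFinB -EFinM lee_fin => acc.
exists (2 / l * (q0 - real_objective l g g' x p0 y p q)), (c0 + q0), (c + q).
rewrite /residual /Phi /bregman xp yp xq yq xc yc fx psix.
split=> //.
- rewrite !(=^~ EFinB, =^~ EFinM, =^~ EFinD, =^~ EFinN); congr (_%:E).
  by rewrite /real_objective; ring.
- by rewrite mulr_gt0 ?divr_gt0 ?subr_gt0.
- rewrite mulrA (_ : l / 2 * (2 / l) = 1) ?mul1r; last by field; rewrite gt_eqF.
  by move: acc; rewrite /real_objective; clear; lra.
Qed.

End BPGStep.

(** * Completed iterations *)

Record valid_inputs (R : realType) (n : nat) (pb : problem R n)
    (al : inputs R n) : Prop := ValidInputs {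
  y0_feasible : feasible pb (y0 al);
  lambda0_bounds : 0 < lambda0 al <= lambda_max al;
  gamma_plus_ge1 : 1 <= gamma_plus al;
  gamma_minus_gt1 : 1 < gamma_minus al;
  sigma_bounds : 0 < sigma al < 1 }.

Section Histories.
Context {R : realType} {n : nat} (pb : problem R n) (al : inputs R n) (L : R).
Context (st : standing pb L) (va : valid_inputs pb al).
Context (phi : 'rV[R]_n -> \bar R).
Local Notation low := (lambda_low al L).
Implicit Types (it : iteration R n) (h : seq (iteration R n)).

Lemma lambda_low_gt0 : 0 < low.
Proof.
have /andP[l0 _] := lambda0_bounds va.
rewrite /lambda_low lt_min l0 divr_gt0 // mulr_gt0 ?(L_gt0 st) //.
by rewrite (lt_trans ltr01) ?(gamma_minus_gt1 va).
Qed.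

Definition progress it : bool := (0 < delta pb it)%E.

Definition good it : bool :=
  ((sigma al * it_lambda it / 2)%:E * it_residual pb it <= delta pb it)%E.

(** A boolean predicate: the type of iterations carries no equality test, so
that histories are handled with all rather than by membership. *)
Definition iteration_ok it : bool :=
  [&& delta pb it \is a fin_num, it_residual pb it \is a fin_num,
      (0 < it_residual pb it)%E & low <= it_lambda it].

Definition rdelta it : R := fine (delta pb it).
Definition rresidual it : R := fine (it_residual pb it).

Lemma iteration_okE it : iteration_ok it ->
  [/\ delta pb it = (rdelta it)%:E, it_residual pb it = (rresidual it)%:E,
      0 < rresidual it & low <= it_lambda it].
Proof.
move=> /and4P[dfin rfin r0 lowl]; rewrite /rdelta /rresidual !fineK //.
by split=> //; rewrite -lte_fin fineK.
Qed.

Lemma good_progress it : iteration_ok it -> good it -> progress it.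
Proof.
move=> /iteration_okE[dE rE r0 lowl]; rewrite /good /progress dE rE -EFinM.
rewrite lee_fin lte_fin; apply: lt_le_trans.
have /andP[s0 _] := sigma_bounds va.
by rewrite !mulr_gt0 // (lt_le_trans lambda_low_gt0).
Qed.

(** By telescoping this is Phi (y_0) - Phi (y_N), as y moves exactly when
delta_k > 0. *)
Definition decrease h : R := \sum_(it <- h | progress it) rdelta it.

(** The sum of the tau_k lambda_k: the parameter lambda_k cancels from the
product. *)
Definition weight h : R :=
  \sum_(it <- h | progress it) 2 * rdelta it / rresidual it.

Lemma total_weightE h : all iteration_ok h ->
  (\sum_(it <- h | (0 < delta pb it)%E) tau pb it * (it_lambda it)%:E)%E
  = (weight h)%:E.
Proof.
move=> /all_filterP hok; rewrite /weight -sumEFin -hok !big_filter_cond.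
apply: eq_bigr => it /andP[/iteration_okE[dE rE r0 lowl] _].
have l0 := lt_le_trans lambda_low_gt0 lowl.
rewrite /tau dE rE -!EFinM inver gt_eqF ?mulr_gt0 // -!EFinM; congr (_%:E).
by field; rewrite !gt_eqF.
Qed.

(** A good iteration has tau_k >= sigma, and lambda_k >= lambda_low. *)
Lemma weight_ge_count h : all iteration_ok h ->
  sigma al * low * (count good h)%:R <= weight h.
Proof.
have /andP[s0 _] := sigma_bounds va; have low0 := lambda_low_gt0.
elim: h => [|it h IH] /=; first by rewrite /weight big_nil mulr0.
move=> /andP[itok /IH{}IH]; rewrite /weight big_cons -/(weight h).
have [dE rE r0 lowl] := iteration_okE itok.
have gp := good_progress itok.
case: ifP => prog; last first.
  by case: (good it) gp prog => [->//|_ _]; rewrite add0n.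
have d0 : 0 < rdelta it by move: prog; rewrite /progress dE lte_fin.
rewrite natrD mulrDr; apply: lerD => //.
have [|_] := boolP (good it); last by rewrite mulr0 !mulr_ge0 ?invr_ge0 // ltW.
rewrite /good dE rE -EFinM lee_fin mulr1 => goodit.
rewrite ler_pdivlMr //.
apply: le_trans (_ : sigma al * it_lambda it * rresidual it <= _).
  by rewrite ler_pM2r // ler_pM2l.
by clear dE rE gp; lra.
Qed.

(** If the residuals of all iterations with delta_k > 0 exceeded m, then 2
delta_k = (tau_k lambda_k) R_k would exceed m tau_k lambda_k for each k, and so
would the sums. *)
Lemma exists_small_residual h (m : R) : all iteration_ok h ->
  2 * decrease h <= m * weight h -> 0 < weight h ->
  has (fun it => progress it && (it_residual pb it <= m%:E)%E) h.
Proof.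
move=> hok le_m w0; apply/negPn/negP => nhas.
(* Strictness holds as soon as one term is present. *)
suff [[w00 _]|] :
    (weight h = 0 /\ decrease h = 0) \/ m * weight h < 2 * decrease h.
  by move: w0; rewrite w00 ltxx.
  by rewrite ltNge le_m.
elim: h hok nhas {le_m w0} => [|it h IH] /=.
  by left; rewrite /weight /decrease !big_nil.
move=> /andP[/iteration_okE[dE rE r0 _] /IH{}IH].
rewrite negb_or => /andP[nit /IH{}IH].
rewrite /weight /decrease !big_cons -/(weight h) -/(decrease h).
case: ifP nit => //= prog; rewrite rE lee_fin -ltNge => mr; right.
have d0 : 0 < rdelta it by move: prog; rewrite /progress dE lte_fin.
have : m * (2 * rdelta it / rresidual it) < 2 * rdelta it.
  by rewrite mulrA ltr_pdivrMr // mulrC ltr_pM2l // mulr_gt0.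
by clear dE rE; case: IH => [[-> ->]|]; rewrite !mulrDr; lra.
Qed.

Lemma has_bigmin_le h (P : pred (iteration R n))
    (F : iteration R n -> \bar R) m :
  has (fun it => P it && (F it <= m)%E) h ->
  (\big[Order.min/+oo]_(it <- h | P it) F it <= m)%E.
Proof.
elim: h => //= it h IH /orP[/andP[Pit Fm]|/IH{}IH]; rewrite big_cons.
  by rewrite Pit ge_min Fm.
by case: ifP; rewrite // ge_min IH orbT.
Qed.

(** The count says that at least half of the iterations are good. The extra
unit when the next iteration starts from an extrapolated point is earned by the
good iteration that precedes it, and pays for that next iteration, which need
not be good. *)
Record history_ok h : Prop := HistoryOk {
  current_x_feasible : feasible pb (current_x pb al phi h);
  current_y_feasible : feasible pb (current_y pb al h);
  history_iterations_ok : all iteration_ok h;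
  history_telescope :
    fine (Phi pb (y0 al)) = fine (Phi pb (current_y pb al h)) + decrease h;
  history_count :
    ((current_x pb al phi h != current_y pb al h) + size h
       <= (count good h).*2)%N }.

Lemma history_ok_nil : history_ok [::].
Proof.
split=> //; try exact: y0_feasible va.
  by rewrite /decrease big_nil addr0.
by rewrite /current_x /current_y /= eqxx.
Qed.

(** A step from x_k = y_(k-1) is good by sufficient decrease and sigma < 1; a
step that is not good is not followed by extrapolation. *)
Lemma history_ok_rcons h (b l : R) yhat :
  let x := current_x pb al phi h in
  history_ok h -> low <= l -> bpg_map pb l x yhat -> yhat <> x ->
  (bregman (smooth_part pb) yhat x
     <= (l^-1)%R%:E * bregman (psi pb) yhat x)%E ->
  history_ok (rcons h (Iteration x (current_y pb al h) b l yhat)).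
Proof.
move=> x [xfeas yfeas hok tele cnt] lowl ymin yx acc.
have l0 := lt_le_trans lambda_low_gt0 lowl.
have yhfeas := bpg_map_feasible st l0 xfeas ymin.
have [r [a [c [rE xa yhc r0 desc]]]] := bpg_accept st l0 xfeas ymin yx acc.
have [e ye] := Phi_real st yfeas.
set it := Iteration _ _ _ _ _.
have dE : delta pb it = (e - c)%:E by rewrite /delta /= ye yhc.
have itok : iteration_ok it.
  by rewrite /iteration_ok dE /it_residual /= rE lte_fin r0 lowl.
have yE : current_y pb al (rcons h it) = it_y pb it.
  by rewrite /current_y map_rcons last_rcons.
have xE : current_x pb al phi (rcons h it) = it_z pb al phi it.
  by rewrite /current_x map_rcons last_rcons.
have ityfeas : feasible pb (it_y pb it) by rewrite /it_y; case: ifP.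
split.
- by rewrite xE /it_z; case: asboolP => // -[].
- by rewrite yE.
- by rewrite all_rcons itok.
- rewrite yE tele /decrease -cats1 big_cat big_cons big_nil /= /it_y /progress.
  case: ifP => _ /=; last by rewrite addr0.
  by rewrite /rdelta dE ye yhc /= addr0; ring.
- rewrite xE yE size_rcons -cats1 count_cat /= addn0 doubleD.
  have [goodit|ngood] := boolP (good it).
    move: cnt; move: (_ != _) (_ != _) => [] []; clear; lia.
  have -> : it_z pb al phi it = it_y pb it.
    by rewrite /it_z; case: asboolP => // -[];
      rewrite -/(good it) (negPf ngood).
  rewrite eqxx.
  case: eqP cnt => [xy _|_] /=; last by clear; lia.
  case/negP: ngood; rewrite /good dE /it_residual /= rE -EFinM lee_fin.
  have ae : a = e by apply: EFin_inj; rewrite -xa -ye xy.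
  have /andP[s0 s1] := sigma_bounds va.
  rewrite -ae; apply: le_trans desc; rewrite -!mulrA ler_piMl ?(ltW s1) //.
  by rewrite !mulr_ge0 // ltW.
Qed.

End Histories.

(** * Runs of the algorithm *)

Section Executions.
Context {R : realType} {n : nat} (pb : problem R n) (al : inputs R n) (L : R).
Context (st : standing pb L) (va : valid_inputs pb al).
Context (phi : 'rV[R]_n -> \bar R).
Local Notation low := (lambda_low al L).
Implicit Types (h : seq (iteration R n)).

Lemma bounded_backtracking :
  exists J : nat, lambda_max al < low * gamma_minus al ^+ J.+1.
Proof.
have g1 := gamma_minus_gt1 va; have low0 := lambda_low_gt0 st va.
pose J := (Num.truncn (lambda_max al / low / (gamma_minus al - 1))).+1.
have HJ : lambda_max al / low / (gamma_minus al - 1) < J%:R.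
  exact: truncnS_gt.
exists J; rewrite mulrC -ltr_pdivrMr //.
rewrite ltr_pdivrMr ?subr_gt0 // in HJ; apply: lt_trans HJ _.
(* Bernoulli's inequality. *)
elim: J => [|J IH]; first by rewrite mul0r exprS expr0; lra.
rewrite exprS -natr1.
set q := gamma_minus al in g1 IH *; set p := q ^+ J.+1 in IH *.
have p1 : 1 <= p by rewrite exprn_ege1 // ltW.
by nra.
Qed.

Lemma backtracks_bounded (J r : nat) (l : R) :
  lambda_max al < low * gamma_minus al ^+ J.+1 -> low <= l ->
  l * gamma_minus al ^+ r <= lambda_max al -> (r < J.+1)%N.
Proof.
move=> HJ lowl lr; have g1 := gamma_minus_gt1 va.
rewrite -(ltr_eXn2l g1) -(ltr_pM2l (lambda_low_gt0 st va)).
apply: le_lt_trans HJ; apply: le_trans lr.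
by rewrite ler_wpM2r // exprn_ge0 // ltW // (lt_trans ltr01).
Qed.

(** State after j subproblem solves. Every completed iteration has cost at most
J + 1 solves; r counts the rejections in the current one, and each of them has
divided a parameter that was at most lambda_max. *)
Definition config_ok (J j : nat) (c : config R n) : Prop :=
  match c with
  | Running h b l =>
      [/\ history_ok pb al L phi h, low <= l <= lambda_max al, (size h <= j)%N &
        exists2 r : nat, (j <= J.+1 * size h + r)%N &
          l * gamma_minus al ^+ r <= lambda_max al]
  | Returned h x =>
      [/\ history_ok pb al L phi h, stationary pb x & (size h < j)%N]
  end.

Lemma first_trial_rcons h it : low <= it_lambda it ->
  low <= first_trial al (rcons h it) <= lambda_max al.
Proof.
move=> lowl; have low0 := lambda_low_gt0 st va.
have -> : first_trial al (rcons h it) =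
    Num.min (gamma_plus al * it_lambda it) (lambda_max al).
  have : last (lambda0 al) [seq it_lambda i | i <- rcons h it] = it_lambda it.
    by rewrite map_rcons last_rcons.
  by case: h => [//|? ?] /= ->.
apply/andP; split; last by rewrite ge_min lexx orbT.
rewrite le_min; apply/andP; split.
  apply: (le_trans lowl); apply: ler_peMl; last exact: gamma_plus_ge1 va.
  exact: le_trans (ltW low0) lowl.
have /andP[_ l01] := lambda0_bounds va.
by apply: le_trans l01; rewrite /lambda_low ge_min lexx.
Qed.

Lemma config_ok_init J b : config_ok J 0 (Running [::] b (first_trial al [::])).
Proof.
have /andP[l0 l01] := lambda0_bounds va.
split=> //=; first exact: history_ok_nil.
  by rewrite l01 andbT /lambda_low ge_min lexx.
by exists 0%N => //; rewrite expr0 mulr1.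
Qed.

Lemma config_ok_step J j c c' : lambda_max al < low * gamma_minus al ^+ J.+1 ->
  config_ok J j c -> step pb al phi c c' -> config_ok J j.+1 c'.
Proof.
move=> HJ cok stp; have low0 := lambda_low_gt0 st va.
have g1 := gamma_minus_gt1 va; have g0 := lt_trans ltr01 g1.
case: stp cok => [h b l fixd|h b l yhat ymin yx rej
  |h b l yhat b' ymin yx acc b'0 h'|h x] /=.
- move=> [hok /andP[lowl _] szj _]; split=> //.
  apply: (bpg_fixed_stationary st _ (current_x_feasible hok) fixd).
  exact: lt_le_trans low0 lowl.
- move=> [hok /andP[lowl lmax] szj [r jr lr]].
  have l0 := lt_le_trans low0 lowl.
  have Ll := bpg_reject_gt st l0 (current_x_feasible hok) ymin rej.
  split=> //; last 2 first.
  + exact: leqW.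
  + exists r.+1; first by rewrite addnS ltnS.
    by rewrite exprS mulrA mulfVK ?gt_eqF.
  + apply/andP; split; last first.
      by apply: le_trans lmax; rewrite ler_pdivrMr // ler_peMr // ltW.
    rewrite /lambda_low ge_min; apply/orP; right.
    rewrite invfM mulrA -/(_ / _) mulrAC; apply: ler_wpM2r (ltW Ll).
    by rewrite invr_ge0 ltW.
- move=> [hok /andP[lowl lmax] szj [r jr lr]].
  have rJ := backtracks_bounded HJ lowl lr.
  split.
  + exact: history_ok_rcons.
  + exact: first_trial_rcons.
  + by rewrite size_rcons.
  + exists 0%N; first by rewrite size_rcons mulnS; lia.
    rewrite expr0 mulr1; pose it := Iteration (current_x pb al phi h)
      (current_y pb al h) b l yhat.
    by case/andP: (first_trial_rcons h (lowl : low <= it_lambda it)).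
- by move=> [? ? ?]; split=> //; exact: leqW.
Qed.

Lemma execution_config_ok J s :
  lambda_max al < low * gamma_minus al ^+ J.+1 ->
  execution pb al phi s -> forall j, config_ok J j (s j).
Proof.
move=> HJ [[b b0 s0] stp]; elim=> [|j IH].
  by rewrite s0; exact: config_ok_init.
exact: config_ok_step HJ IH (stp j).
Qed.

Lemma config_ok_history J j c :
  config_ok J j c -> history_ok pb al L phi (history c).
Proof. by case: c => [h b l|h x] []. Qed.

Lemma config_ok_outer J j c : config_ok J j c -> (outer_iterations c <= j)%N.
Proof. by case: c => [h b l|h x] []. Qed.

Lemma config_ok_size J N c : lambda_max al < low * gamma_minus al ^+ J.+1 ->
  config_ok J (J.+1 * N) c ->
  (exists h x, c = Returned h x) \/ (N <= size (history c))%N.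
Proof.
move=> HJ; case: c => [h b l|h x]; last by move=> _; left; exists h, x.
move=> [_ /andP[lowl _] _ [r Nr lr]]; right; rewrite /=.
have rJ := backtracks_bounded HJ lowl lr.
rewrite -ltnS -(ltn_pmul2l (ltn0Sn J)); apply: leq_ltn_trans Nr _.
by rewrite mulnS addnC ltn_add2r.
Qed.

Lemma history_size_step c c' : step pb al phi c c' ->
  (size (history c') <= (size (history c)).+1)%N.
Proof. by case=> //= *; rewrite ?size_rcons. Qed.

(** The number of completed iterations grows by at most one per solve, so it
takes all values up to the one reached. *)
Lemma reaches_size s N : execution pb al phi s -> ~ returned_within s N ->
  exists j, size (history (s j)) = N.
Proof.
move=> exs nret; have [J HJ] := bounded_backtracking.
have big : exists j, (N <= size (history (s j)))%N.
  exists (J.+1 * N)%N.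
  have [[h [x sE]]|//] :=
    config_ok_size HJ (execution_config_ok HJ exs (J.+1 * N)%N).
  rewrite leqNgt; apply/negP => hN; apply: nret.
  by exists (J.+1 * N)%N, h, x; split=> //; rewrite sE in hN.
case: (ex_minnP big) => -[|j] Nj minj; have [[b _ s0] stp] := exs.
  by exists 0%N; move: Nj; rewrite s0 /= leqn0 => /eqP ->.
exists j.+1; apply/eqP; rewrite eqn_leq Nj andbT.
apply: leq_trans (history_size_step (stp j)) _.
by rewrite ltnNge; apply/negP => /minj; rewrite ltnn.
Qed.

Lemma gap_real :
  exists2 g : R, (Phi pb (y0 al) - Phi_star pb)%E = g%:E & 0 <= g.
Proof.
have [a ya] := Phi_real st (y0_feasible va).
have := Phi_star_le (y0_feasible va); rewrite ya.
case: (Phi_star pb) (Phi_star_gtNy st) => // c _; rewrite lee_fin => ca.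
by exists (a - c); rewrite ?subr_ge0.
Qed.

Lemma decrease_le_gap h (g : R) : history_ok pb al L phi h ->
  (Phi pb (y0 al) - Phi_star pb)%E = g%:E -> decrease pb h <= g.
Proof.
move=> hok gE; have := history_telescope hok.
have [a ya] := Phi_real st (y0_feasible va).
have [c yc] := Phi_real st (current_y_feasible hok).
have := Phi_star_le (current_y_feasible hok); rewrite ya yc /=.
move: gE; rewrite ya; case: (Phi_star pb) (Phi_star_gtNy st) => // e _ /=.
by move=> [<-]; rewrite lee_fin => ec ->; clear ya yc; lra.
Qed.

Lemma weight_ge_size h : history_ok pb al L phi h ->
  sigma al * low * (size h)%:R / 2 <= weight pb h.
Proof.
move=> hok; apply: le_trans (weight_ge_count st va (history_iterations_ok hok)).
have /andP[s0 _] := sigma_bounds va; have low0 := lambda_low_gt0 st va.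
rewrite -mulrA ler_pM2l ?mulr_gt0 // ler_pdivrMr // -natrM ler_nat muln2.
exact: leq_trans (leq_addl _ _) (history_count hok).
Qed.

Lemma small_residual_bound h (g : R) :
  history_ok pb al L phi h -> (0 < size h)%N ->
  (Phi pb (y0 al) - Phi_star pb)%E = g%:E ->
  has (fun it => progress pb it &&
    (it_residual pb it <= (2 * g / weight pb h)%:E)%E) h.
Proof.
move=> hok h0 gE; have /andP[s0 _] := sigma_bounds va.
have w0 : 0 < weight pb h.
  apply: lt_le_trans (weight_ge_size hok).
  by rewrite !mulr_gt0 ?invr_gt0 ?ltr0n // (lambda_low_gt0 st va).
apply: (exists_small_residual (history_iterations_ok hok)) => //.
by rewrite mulfVK ?gt_eqF // ler_pM2l //; exact: decrease_le_gap gE.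
Qed.

Lemma residual_bound_le h (g : R) :
  history_ok pb al L phi h -> (0 < size h)%N ->
  0 <= g -> 2 * g / weight pb h <= 4 * g / (sigma al * low * (size h)%:R).
Proof.
move=> hok h0 g0; have /andP[s0 _] := sigma_bounds va.
have low0 := lambda_low_gt0 st va; have := weight_ge_size hok.
set D := sigma al * low * _ => wD.
have D0 : 0 < D by rewrite !mulr_gt0 ?ltr0n.
have -> : 4 * g / D = 2 * g / (D / 2) by field; rewrite gt_eqF.
apply: ler_wpM2l; first by rewrite mulr_ge0.
by rewrite lef_pV2 // posrE; lra.
Qed.

End Executions.

Theorem mainTheorem3 (R : realType) (n : nat)
    (pb : problem R n) (al : inputs R n) (L : R) :
  legendre (psi pb) ->
  eproper (smooth_part pb) ->
  lower_semicontinuous (smooth_part pb) ->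
  edom (psi pb) `<=` edom (smooth_part pb) ->
  C1_on (Omega pb) (smooth_part pb) ->
  eproper (rho pb) ->
  lower_semicontinuous (rho pb) ->
  econvex (rho pb) ->
  Omega pb `&` edom (rho pb) !=set0 ->
  0 < L ->
  (forall u v, Omega pb u -> Omega pb v ->
     (bregman (smooth_part pb) u v <= L%:E * bregman (psi pb) u v)%E) ->
  (-oo < Phi_star pb)%E ->
  (forall x (l : R), Omega pb x -> 0 < l -> bpg_map pb l x !=set0) ->
  (Omega pb `&` edom (rho pb)) (y0 al) ->
  0 < lambda0 al <= lambda_max al ->
  1 <= gamma_plus al ->
  1 < gamma_minus al ->
  0 < sigma al < 1 ->
  (forall (phi : 'rV[R]_n -> \bar R) (s : nat -> config R n) (N : nat),
     legendre phi -> execution pb al phi s ->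
     (2 <= N)%N -> ~ returned_within s N ->
     (exists j, size (history (s j)) = N) /\
     forall j, size (history (s j)) = N ->
       let h := history (s j) in
       let gap := (Phi pb (y0 al) - Phi_star pb)%E in
       let total :=
         (\sum_(it <- h | (0 < delta pb it)%E)
            tau pb it * (it_lambda it)%:E)%E in
       (\big[Order.min/+oo]_(it <- h | 0 < delta pb it) it_residual pb it
          <= 2%:E * gap / total)%E /\
       (2%:E * gap / total
          <= 4%:E * gap / (sigma al * lambda_low al L * (N%:R - 1))%R%:E)%E)
  /\
  (exists K M : R,
     forall (phi : 'rV[R]_n -> \bar R) (s : nat -> config R n) (eps : R),
       legendre phi -> execution pb al phi s -> 0 < eps <= 1 ->
       exists j : nat,
         [/\ (outer_iterations (s j))%:R <= K * eps ^- 2,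
             j%:R <= M * eps ^- 2
           & returned_stationary pb (s j) \/
             has (fun it => (it_residual pb it <= (eps ^+ 2)%:E)%E)
                 (history (s j))]).
Proof.
move=> psiL fp _ domf _ rp _ rc _ L0 bregL Pstar _ y0f l0 gp gm sg.
have st : standing pb L by split.
have va : valid_inputs pb al by split.
have [g gE g0] := gap_real st va; have /andP[s0 s1] := sg.
have low0 := lambda_low_gt0 st va; have [J HJ] := bounded_backtracking st va.
split.
  move=> phi s N _ exs N2 nret.
  split; first exact: (reaches_size st va exs nret).
  move=> j sizeN.
  have hok := config_ok_history (execution_config_ok st va HJ exs j).
  move: hok sizeN; set h := history (s j) => hok sizeN.
  have h0 : (0 < size h)%N by rewrite sizeN; exact: ltn_trans N2.
  have N1 : 0 < N%:R - 1 :> R by rewrite subr_gt0 ltr1n.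
  have D0 : 0 < sigma al * lambda_low al L * (N%:R - 1) by rewrite !mulr_gt0.
  have w0 : 0 < weight pb h.
    apply: lt_le_trans (weight_ge_size st va hok).
    by rewrite !mulr_gt0 ?invr_gt0 ?ltr0n.
  rewrite /= (total_weightE st va (history_iterations_ok hok)) gE.
  rewrite -!EFinM !inver !gt_eqF // -!EFinM; split.
    exact: (has_bigmin_le (small_residual_bound st va hok h0 gE)).
  rewrite lee_fin; apply: le_trans (residual_bound_le st va hok h0 g0) _.
  apply: ler_wpM2l; first by rewrite mulr_ge0.
  rewrite lef_pV2 ?posrE ?mulr_gt0 ?ltr0n // sizeN ler_pM2l ?mulr_gt0 //.
  by rewrite gerBl.
(* The bound 4 g / (sigma lambda_low N) is at most eps^2 for N at least A /
eps^2; J + 1 solves per iteration suffice. *)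
pose A := 4 * g / (sigma al * lambda_low al L).
have A0 : 0 <= A by rewrite divr_ge0 ?mulr_ge0 // ltW // mulr_gt0.
exists (J.+1%:R * (A + 1)), (J.+1%:R * (A + 1)) => phi s eps _ exs /andP[e0 e1].
have e2 : 0 < eps ^- 2 by rewrite invr_gt0 exprn_gt0.
have e21 : 1 <= eps ^- 2 by rewrite invf_ge1 ?exprn_gt0 // exprn_ile1 // ltW.
pose N := (Num.truncn (A * eps ^- 2)).+1.
have N_gt : A * eps ^- 2 < N%:R by exact: truncnS_gt.
have N_le : N%:R <= (A + 1) * eps ^- 2.
  rewrite mulrDl mul1r -natr1; apply: lerD => //.
  by rewrite truncn_le mulr_ge0 // ltW.
have jM : (J.+1 * N)%:R <= J.+1%:R * (A + 1) * eps ^- 2 :> R.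
  rewrite natrM -mulrA; apply: ler_wpM2l; [exact: ler0n|exact: N_le].
have cok := execution_config_ok st va HJ exs (J.+1 * N)%N.
exists (J.+1 * N)%N; split=> //.
  by apply: le_trans jM; rewrite ler_nat; exact: config_ok_outer cok.
have [[h [x sE]]|Nh] := config_ok_size st va HJ cok.
  by left; exists h, x; split=> //; move: cok; rewrite sE => -[].
right; have hok := config_ok_history cok.
have h0 : (0 < size (history (s (J.+1 * N)%N)))%N by exact: leq_trans Nh.
apply: sub_has (small_residual_bound st va hok h0 gE) => it.
move=> /andP[_ /le_trans]; apply.
rewrite lee_fin; apply: le_trans (residual_bound_le st va hok h0 g0) _.
rewrite invfM mulrA -/A ler_pdivrMr ?ltr0n // mulrC.
rewrite -ler_pdivrMr ?exprn_gt0 //; apply: ltW; apply: lt_le_trans N_gt _.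
by rewrite ler_nat.
Qed.
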